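(* Let $\mathcal{G}=(G_1,G_2,\ldots,G_n,\ldots)$ be any sequence of simple connected graphs, where $G_n$ has vertex set $[n]=\{1,\ldots,n\}$. Define $t=t(n)=\min\{r \mid P_{\mathcal{G}}(n,r)\ge 1/2\}$. Then $t$ is a threshold for $\mathcal{G}$, i.e. $t\in th(\mathcal{G})$.
   Context: A distribution of pebbles on a graph $G$ with vertex set $[n]$ is a function $D:[n]\to\mathbf{N}$ (nonnegative integers); its size is $\sum_i D(i)$. A pebbling step $[v,v']$ removes two pebbles from a vertex $v$ and places one pebble on an adjacent vertex $v'$. A distribution $D$ is $z$-solvable if, by a sequence of pebbling steps, one can reach a distribution with at least one pebble on $z$; $D$ is solvable if it is $z$-solvable for every vertex $z$. Pebbles are unlabeled and vertices labeled. $P_{\mathcal{G}}(n,t)$ denotes the probability that a distribution chosen uniformly at random from all distributions of size $t$ on $[n]$ is solvable on $G_n$. A function $t=t(n)$ is a threshold for $\mathcal{G}$, written $t\in th(\mathcal{G})$, if for every function $\omega=\omega(n)\to\infty$: (i) $P_{\mathcal{G}}(n,t\omega)\to 1$ and (ii) $P_{\mathcal{G}}(n,t/\omega)\to 0$ as $n\to\infty$ (non-integer values $t\omega$, $t/\omega$ are rounded to the nearest integer). *)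

(* Defs.v *)
(* MathComp / MathComp-Analysis. *)
From Stdlib Require Import Relation_Operators.
From mathcomp Require Import all_boot all_order all_algebra.
From mathcomp Require Import all_classical all_reals all_analysis.
Set Implicit Arguments.
Unset Strict Implicit.
Unset Printing Implicit Defensive.
Import Order.TTheory GRing.Theory Num.Theory.
Import numFieldNormedType.Exports.
Local Open Scope classical_set_scope.
Local Open Scope ring_scope.

Section Pebbling.
Variables (V : finType) (e : rel V).

Definition simple_graph : Prop := symmetric e /\ irreflexive e.

Definition connected_graph : Prop := forall x y : V, connect e x y.

Definition distribution : Type := {ffun V -> nat}.

(* [move D v v'] is meaningful only when D has two pebbles on v; the
   subtraction is truncated otherwise. *)
Definition move (D : distribution) (v v' : V) : distribution :=
  [ffun u => (D u - 2 * (u == v) + (u == v'))%N].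

Definition pebbling_step (D D' : distribution) : Prop :=
  exists v v' : V, [/\ e v v', (2 <= D v)%N & D' = move D v v'].

Definition reachable : distribution -> distribution -> Prop :=
  clos_refl_trans distribution pebbling_step.

Definition solvable_at (z : V) (D : distribution) : Prop :=
  exists D' : distribution, reachable D D' /\ (1 <= D' z)%N.

Definition solvable (D : distribution) : Prop :=
  forall z : V, solvable_at z D.

(* In a distribution of size r no vertex carries more than r pebbles, so these
   distributions are the functions V -> {0, .., r} with sum r. *)
Definition distributions_of_size (r : nat) : {set {ffun V -> 'I_r.+1}} :=
  [set D : {ffun V -> 'I_r.+1} | (\sum_v D v == r)%N].

Definition solvable_of_size (r : nat) : {set {ffun V -> 'I_r.+1}} :=
  [set D in distributions_of_size r | `[< solvable [ffun v => D v : nat] >]].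

End Pebbling.

Section Threshold.
Variables (R : realType) (G : forall n : nat, rel 'I_n).

(* For n = 0 and r > 0 there is no distribution, and the value is 0 / 0 = 0. *)
Definition solvable_prob (n r : nat) : R :=
  #|solvable_of_size (@G n) r|%:R / #|distributions_of_size 'I_n r|%:R.

(* Ties are rounded up; negative reals are sent to 0. *)
Definition nearest_nat (x : R) : nat := Num.truncn (x + 2^-1).

Definition is_threshold (t : nat -> R) : Prop :=
  forall w : nat -> R, w n @[n --> \oo] --> +oo ->
    solvable_prob n (nearest_nat (t n * w n)) @[n --> \oo] --> (1 : R) /\
    solvable_prob n (nearest_nat (t n / w n)) @[n --> \oo] --> (0 : R).

(* The least r with probability at least 1/2; the default value 0 is used only
   if there is no such r, which does not happen when G n is connected. *)
Definition median_size (n : nat) : nat :=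
  xget 0%N [set r : nat | 2^-1 <= solvable_prob n r /\
                          forall s : nat, 2^-1 <= solvable_prob n s -> (r <= s)%N].

End Threshold.

(* Main.v *)
From Stdlib Require Import Relation_Operators.
Require Import Defs.
From mathcomp Require Import all_boot all_order all_algebra.
From mathcomp Require Import all_classical all_reals all_analysis.
From mathcomp Require Import ring lra zify.
Set Implicit Arguments.
Unset Strict Implicit.
Unset Printing Implicit Defensive.
Import Order.TTheory GRing.Theory Num.Theory.
Import numFieldNormedType.Exports.
Local Open Scope ring_scope.

(** The geometric law of parameter [q] is closed under the two operations that
drive the Bollobas-Thomason argument: the minimum of independent geometric
variables of parameters [a] and [b] is geometric of parameter [a * b], and their
maximum is dominated by the geometric law of parameter [a + b].  For an
increasing family [P] of multisets and the product measure [mu_q] this gives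
[mu_(q^k) P <= (mu_q P)^k] and [1 - mu_(k q) P <= (1 - mu_q P)^k].  The first
inequality, used for [q] bounded away from 0, and the second, used for small
[q], show that multiplying the mean by a constant depending only on [d] moves
the probability of [P] from above [d] to at least [1 - d].  Given its size, a
[mu_q]-random multiset is uniform; since the uniform probability of [P] is
increasing in the size, crude tail bounds for the size transfer the estimate to
uniform multisets of fixed size.  Solvability is increasing, whence the
theorem. *)

Lemma bernoulli (R : realFieldType) (x : R) (n : nat) :
  -1 <= x -> 1 + n%:R * x <= (1 + x) ^+ n.
Proof.
move=> x1; elim: n => [|n IHn]; first by rewrite mul0r addr0 expr0.
have x10 : 0 <= 1 + x by lra.
rewrite exprSr; apply: le_trans (ler_wpM2r x10 IHn).
have := mulr_ge0 (ler0n R n) (sqr_ge0 x); rewrite -(natr1 n) expr2; nra.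
Qed.

(** * Capped geometric laws *)

Section GeometricProduct.
Variable R : realFieldType.
Implicit Types (q a b c : R) (phi psi : nat -> R) (f g : seq nat -> R).

(* Expectation of [phi] under the geometric law P(X >= j) = q^j capped at [N],
   computed by the memoryless recursion; [vecE] takes [n] independent copies.
   Multisets on [n] elements are represented by words of [n] multiplicities. *)
Fixpoint geoE q (N : nat) phi : R :=
  if N is N'.+1 then (1 - q) * phi 0%N + q * geoE q N' (fun j => phi j.+1)
  else phi 0%N.

Fixpoint vecE q (N n : nat) f : R :=
  if n is n'.+1 then geoE q N (fun j => vecE q N n' (fun w => f (j :: w)))
  else f [::].

Lemma geoED q N phi psi :
  geoE q N (fun j => phi j + psi j) = geoE q N phi + geoE q N psi.
Proof. elim: N phi psi => [|N IHN] phi psi //=; rewrite IHN; ring. Qed.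

Lemma geoEZ q N c phi : geoE q N (fun j => c * phi j) = c * geoE q N phi.
Proof. elim: N phi => [|N IHN] phi //=; rewrite IHN; ring. Qed.

Lemma geoE_cst q N c : geoE q N (fun=> c) = c.
Proof. elim: N => [|N IHN] //=; rewrite IHN; ring. Qed.

Lemma geoE_le q N phi psi : 0 <= q <= 1 -> (forall j, phi j <= psi j) ->
  geoE q N phi <= geoE q N psi.
Proof.
move=> /andP[q0 q1]; elim: N phi psi => [|N IHN] phi psi le_pp //=.
by rewrite lerD ?ler_wpM2l ?subr_ge0 // IHN.
Qed.

Lemma geoE_ge0 q N phi : 0 <= q <= 1 -> (forall j, 0 <= phi j) ->
  0 <= geoE q N phi.
Proof. by move=> q01 /(geoE_le N q01); rewrite geoE_cst. Qed.

(** Below the cap the weights are those of the uncapped law; [s < N] keeps the atom at [N] outside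
    the support of [phi]. *)
Lemma geoE_supp q N s phi : (s < N)%N -> (forall j, (s < j)%N -> phi j = 0) ->
  geoE q N phi = \sum_(j < s.+1) (1 - q) * q ^+ j * phi j.
Proof.
elim: N s phi => [|N IHN] [|s] phi //=.
  move=> _ phi0; rewrite big_ord1 expr0 mulr1.
  under eq_fun do rewrite phi0 //.
  by rewrite geoE_cst mulr0 addr0.
move=> sN phi0; rewrite big_ord_recl expr0 mulr1 (IHN s) //; last first.
  by move=> j sj; apply: phi0.
by rewrite mulr_sumr; congr (_ + _); apply: eq_bigr => j _; rewrite exprS; ring.
Qed.

Lemma geoE_val_le q N : 0 <= q < 1 -> geoE q N (fun j => j%:R) <= q / (1 - q).
Proof.
move=> /andP[q0 q1]; have q1' : 0 < 1 - q by lra.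
elim: N => [|N IHN] /=; first by rewrite divr_ge0 // ltW.
under eq_fun do rewrite -natr1.
rewrite geoED geoE_cst mulr0 add0r.
(* The uncapped mean [q / (1 - q)] is the fixed point of the recursion [x = q * (x + 1)]. *)
have -> : q / (1 - q) = q * (q / (1 - q) + 1) by field; lra.
by rewrite ler_wpM2l // lerD2r.
Qed.

(* The restriction to [j < N] discards the atom at the cap, so that the bound
   is the generating function of the uncapped law. *)
Lemma geoE_pgf_le q z N : 0 <= q < 1 -> 0 <= z <= 1 ->
  geoE q N (fun j => (j < N)%:R * z ^+ j) <= (1 - q) / (1 - z * q).
Proof.
move=> /andP[q0 q1] /andP[z0 z1]; have zq : 0 < 1 - z * q by nra.
elim: N => [|N IHN] /=; first by rewrite mul0r divr_ge0 //; lra.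
rewrite expr0 !mulr1.
under eq_fun do rewrite ltnS exprS mulrCA.
rewrite geoEZ.
have -> : (1 - q) / (1 - z * q) =
    (1 - q) + q * (z * ((1 - q) / (1 - z * q))) by field; lra.
by rewrite lerD2l !ler_wpM2l.
Qed.

Lemma vecED q N n f g :
  vecE q N n (fun w => f w + g w) = vecE q N n f + vecE q N n g.
Proof.
elim: n f g => [|n IHn] f g //=; rewrite -geoED.
by congr geoE; apply/funext => j; rewrite IHn.
Qed.

Lemma vecEZ q N n c f : vecE q N n (fun w => c * f w) = c * vecE q N n f.
Proof.
elim: n f => [|n IHn] f //=; rewrite -geoEZ.
by congr geoE; apply/funext => j; rewrite IHn.
Qed.

Lemma vecE_cst q N n c : vecE q N n (fun=> c) = c.
Proof.
by elim: n => [|n IHn] //=; under eq_fun do rewrite IHn; rewrite geoE_cst.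
Qed.

Lemma vecE_le q N n f g : 0 <= q <= 1 -> (forall w, f w <= g w) ->
  vecE q N n f <= vecE q N n g.
Proof.
move=> q01; elim: n f g => [|n IHn] f g le_fg //=.
by apply: geoE_le => // j; apply: IHn.
Qed.

Lemma vecE_ge0 q N n f : 0 <= q <= 1 -> (forall w, 0 <= f w) ->
  0 <= vecE q N n f.
Proof. by move=> q01 /(vecE_le N n q01); rewrite vecE_cst. Qed.

Lemma vecE_sum q N n (I : Type) (r : seq I) (F : I -> seq nat -> R) :
  vecE q N n (fun w => \sum_(i <- r) F i w) = \sum_(i <- r) vecE q N n (F i).
Proof.
elim: r => [|i r IHr].
  by under eq_fun do rewrite big_nil; rewrite vecE_cst big_nil.
by under eq_fun do rewrite big_cons; rewrite vecED IHr big_cons.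
Qed.

Lemma vecE_prod q N n phi :
  vecE q N n (fun w => \prod_(j <- w) phi j) = geoE q N phi ^+ n.
Proof.
elim: n => [|n IHn] /=; first by rewrite big_nil.
rewrite exprSr -IHn -geoEZ; congr geoE; apply/funext => j.
by under eq_fun do rewrite big_cons; rewrite vecEZ mulrC.
Qed.

(** * Tail bounds for the size of a random multiset *)

Lemma vecE_sumn_le q N n : 0 <= q < 1 ->
  vecE q N n (fun w => (sumn w)%:R) <= n%:R * (q / (1 - q)).
Proof.
move=> q01; elim: n => [|n IHn] /=; first by rewrite mul0r.
under eq_fun => j do under eq_fun do rewrite natrD.
under eq_fun => j do rewrite vecED vecE_cst.
by rewrite geoED geoE_cst -natr1 mulrDl mul1r addrC lerD // geoE_val_le.
Qed.

(** Markov's inequality. *)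
Lemma vecE_upper_tail q N n m : 0 <= q < 1 ->
  vecE q N n (fun w => (m <= sumn w)%:R) * m%:R <= n%:R * (q / (1 - q)).
Proof.
move=> q01; apply: le_trans (vecE_sumn_le N n q01).
have /andP[q0 q1] := q01.
rewrite mulrC -vecEZ; apply: vecE_le; first by rewrite q0 ltW.
by move=> w; case: leqP => mw; rewrite ?mulr1 ?mulr0 ?ler_nat.
Qed.

Lemma prod_ltn_expr (z : R) N (w : seq nat) :
  \prod_(j <- w) ((j < N)%:R * z ^+ j) = (all (ltn^~ N) w)%:R * z ^+ sumn w.
Proof.
elim: w => [|j w IHw]; first by rewrite big_nil expr0 mulr1.
rewrite big_cons IHw /= exprD; case: (j < N)%N; rewrite /= ?mul0r //.
by rewrite !mul1r mulrCA.
Qed.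

(** Markov's inequality for [z ^+ sumn w], with [z = 1 - 1 / (2 * s)] chosen so that
    [z ^+ s >= 1 / 2]. The generating function of one entry is at most [1 / (1 + y)] with
    [n * y >= 4], so the probability is at most [2 / 5]. *)
Lemma vecE_lower_tail q N n s : 0 <= q < 1 -> (0 < s <= N)%N ->
  8 * s%:R * (1 - q) <= n%:R * q ->
  vecE q N n (fun w => (sumn w < s)%:R) <= 2^-1.
Proof.
move=> q01 /andP[s0 sN] mean; have /andP[q0 q1] := q01.
have s1 : 1 <= s%:R :> R by rewrite ler1n.
have s0' : s%:R != 0 :> R by lra.
pose x : R := (2 * s%:R)^-1.
have xE : s%:R * x = 2^-1 by rewrite /x; field.
have x0 : 0 < x by rewrite invr_gt0; lra.
have x1 : x <= 2^-1 by nra.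
pose z : R := 1 - x.
have z01 : 0 <= z <= 1 by rewrite /z; lra.
have zs : 2^-1 <= z ^+ s.
  have xN1 : -1 <= - x by lra.
  by have := bernoulli s xN1; rewrite mulrN xE -/z; lra.
pose phi j : R := (j < N)%:R * z ^+ j.
apply: (@le_trans _ _ (2 * geoE q N phi ^+ n)).
  rewrite -vecE_prod -vecEZ; apply: vecE_le; first by rewrite q0 ltW.
  move=> w; rewrite prod_ltn_expr; case: ltnP => ws; last first.
    by rewrite !mulr_ge0 ?ler0n ?exprn_ge0 //; case/andP: z01.
  (* Entries are at most the sum, hence below the cap. *)
  have -> : all (ltn^~ N) w.
    apply/allP => j jw /=; apply: leq_trans sN; apply: leq_ltn_trans ws.
    by rewrite sumnE (big_rem j) //= leq_addr.
  have : z ^+ s <= z ^+ sumn w.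
    by rewrite ler_wiXn2l ?(ltnW ws)//; case/andP: z01.
  by rewrite mul1r mulr1n; lra.
pose y : R := q / (1 - q) * x.
have y0 : 0 <= y by rewrite mulr_ge0 ?divr_ge0 //; lra.
have ny : 4 <= n%:R * y.
  have q1' : 1 - q != 0 by lra.
  have -> : n%:R * y = n%:R * q / (2 * s%:R * (1 - q)).
    by rewrite /y /x; field; lra.
  rewrite ler_pdivlMr; first lra.
  by rewrite !mulr_gt0; lra.
have geo_le : geoE q N phi <= (1 + y)^-1.
  apply: (le_trans (geoE_pgf_le N q01 z01)).
  have -> : (1 + y)^-1 = (1 - q) / (1 - z * q) => //.
  rewrite /y /z; field; apply/andP; split; nra.
have geo0 : 0 <= geoE q N phi.
  apply: geoE_ge0; first by rewrite q0 ltW.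
  by move=> j; rewrite mulr_ge0 ?exprn_ge0//; case/andP: z01.
have yN1 : -1 <= y by lra.
have b5 : 5 <= (1 + y) ^+ n by have := bernoulli n yN1; lra.
have : geoE q N phi ^+ n <= (1 + y)^-1 ^+ n.
  by rewrite lerXn2r ?nnegrE ?invr_ge0//; lra.
rewrite exprVn => le1; have : ((1 + y) ^+ n)^-1 <= 5^-1.
  by rewrite lef_pV2 ?posrE//; lra.
lra.
Qed.

(** * Product inequalities for monotone functions *)

(* The minimum of independent geometric variables of parameters [a] and [b] is
   geometric of parameter [a * b]; for increasing [phi] and [psi] one has
   phi (min X Y) * psi (min X Y) <= phi X * psi Y. *)
Lemma geoE_mul_min a b N phi psi : 0 <= a <= 1 -> 0 <= b <= 1 ->
  (forall j, 0 <= phi j) -> (forall j, 0 <= psi j) ->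
  {homo phi : i j / (i <= j)%N >-> i <= j} ->
  {homo psi : i j / (i <= j)%N >-> i <= j} ->
  geoE (a * b) N (fun j => phi j * psi j) <= geoE a N phi * geoE b N psi.
Proof.
move=> a01 b01; elim: N phi psi => [|N IHN] phi psi phi0 psi0 phiS psiS //=.
have le_phi : phi 0%N <= geoE a N (fun j => phi j.+1).
  by rewrite -[leLHS](geoE_cst a N); apply: geoE_le => // j; apply: phiS.
have le_psi : psi 0%N <= geoE b N (fun j => psi j.+1).
  by rewrite -[leLHS](geoE_cst b N); apply: geoE_le => // j; apply: psiS.
have : geoE (a * b) N (fun j => phi j.+1 * psi j.+1) <=
    geoE a N (fun j => phi j.+1) * geoE b N (fun j => psi j.+1).
  by apply: IHN => // i j ij; [apply: phiS | apply: psiS].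
move: le_phi le_psi (phi0 0%N) (psi0 0%N).
move: (phi 0%N) (psi 0%N) (geoE a N _) (geoE b N _) (geoE (a * b) N _).
move=> x y X Y Z xX yY x0 y0 ZXY.
case/andP: a01 b01 => a0 a1 /andP[b0 b1].
(* The right side minus the left side is the sum of these three terms. *)
have t1 : 0 <= (1 - a) * b * (x * (Y - y)) by rewrite !mulr_ge0 //; lra.
have t2 : 0 <= a * (1 - b) * (y * (X - x)) by rewrite !mulr_ge0 //; lra.
have t3 : 0 <= a * b * (X * Y - Z) by rewrite !mulr_ge0 //; lra.
rewrite -subr_ge0; apply: le_trans (addr_ge0 (addr_ge0 t1 t2) t3) _.
rewrite le_eqVlt; apply/orP; left; apply/eqP; ring.
Qed.

(* The maximum of the same variables is stochastically dominated by a geometric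
   variable of parameter [a + b]. *)
Lemma geoE_mul_max a b N phi psi : 0 <= a -> 0 <= b -> a + b <= 1 ->
  (forall j, 0 <= phi j) -> (forall j, 0 <= psi j) ->
  {homo phi : i j / (j <= i)%N >-> i <= j} ->
  {homo psi : i j / (j <= i)%N >-> i <= j} ->
  geoE (a + b) N (fun j => phi j * psi j) <= geoE a N phi * geoE b N psi.
Proof.
move=> a0 b0 ab1; have a01 : 0 <= a <= 1 by lra. have b01 : 0 <= b <= 1 by lra.
elim: N phi psi => [|N IHN] phi psi phi0 psi0 phiS psiS //=.
have le_phi : geoE a N (fun j => phi j.+1) <= phi 0%N.
  by rewrite -[leRHS](geoE_cst a N); apply: geoE_le => // j; apply: phiS.
have le_psi : geoE b N (fun j => psi j.+1) <= psi 0%N.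
  by rewrite -[leRHS](geoE_cst b N); apply: geoE_le => // j; apply: psiS.
have : geoE (a + b) N (fun j => phi j.+1 * psi j.+1) <=
    geoE a N (fun j => phi j.+1) * geoE b N (fun j => psi j.+1).
  by apply: IHN => // i j ij; [apply: phiS | apply: psiS].
have X0 : 0 <= geoE a N (fun j => phi j.+1) by apply: geoE_ge0.
have Y0 : 0 <= geoE b N (fun j => psi j.+1) by apply: geoE_ge0.
move: le_phi le_psi (phi0 0%N) (psi0 0%N) X0 Y0.
move: (phi 0%N) (psi 0%N) (geoE a N _) (geoE b N _) (geoE (a + b) N _).
move=> x y X Y Z xX yY x0 y0 X0 Y0 ZXY.
have t1 : 0 <= (1 - a) * b * ((x - X) * Y) by rewrite !mulr_ge0 //; lra.
have t2 : 0 <= a * (1 - b) * (X * (y - Y)) by rewrite !mulr_ge0 //; lra.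
have t3 : 0 <= a * b * ((x - X) * y) by rewrite !mulr_ge0 //; lra.
have t4 : 0 <= a * b * (X * (y - Y)) by rewrite !mulr_ge0 //; lra.
have t5 : 0 <= (a + b) * (X * Y - Z) by rewrite !mulr_ge0 //; lra.
rewrite -subr_ge0.
apply: le_trans (addr_ge0 (addr_ge0 (addr_ge0 (addr_ge0 t1 t2) t3) t4) t5) _.
rewrite le_eqVlt; apply/orP; left; apply/eqP; ring.
Qed.

(** Tensorisation: induction handles the tail for a fixed head, then the one-variable inequality is
    applied to the partial expectations. Taking [r] to be [leq] or [geq] covers increasing and
    decreasing functions. *)
Lemma vecE_mul (r : rel nat) a b c N n f g : reflexive r ->
  0 <= a <= 1 -> 0 <= b <= 1 -> 0 <= c <= 1 ->
  (forall phi psi, (forall j, 0 <= phi j) -> (forall j, 0 <= psi j) ->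
     {homo phi : i j / r i j >-> i <= j} ->
     {homo psi : i j / r i j >-> i <= j} ->
     geoE c N (fun j => phi j * psi j) <= geoE a N phi * geoE b N psi) ->
  (forall w, 0 <= f w) -> (forall w, 0 <= g w) ->
  {homo f : w w' / all2 r w w' >-> w <= w'} ->
  {homo g : w w' / all2 r w w' >-> w <= w'} ->
  vecE c N n (fun w => f w * g w) <= vecE a N n f * vecE b N n g.
Proof.
move=> rr a01 b01 c01 mul1; have rr2 w : all2 r w w.
  by elim: w => //= j w ->; rewrite rr.
elim: n f g => [|n IHn] f g f0 g0 fS gS //=.
apply: (@le_trans _ _ (geoE c N (fun j =>
    vecE a N n (fun w => f (j :: w)) * vecE b N n (fun w => g (j :: w))))).
  apply: geoE_le => // j; apply: IHn => // w w' ww'.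
    by apply: fS; rewrite /= rr.
  by apply: gS; rewrite /= rr.
apply: mul1 => [j|j|i j ij|i j ij].
- exact: vecE_ge0.
- exact: vecE_ge0.
- by apply: vecE_le => // w; apply: fS; rewrite /= ij rr2.
- by apply: vecE_le => // w; apply: gS; rewrite /= ij rr2.
Qed.

(** Since [all2] fails on different lengths, only words of equal length are compared, by inclusion
    of multisets. *)
Definition upset (P : pred (seq nat)) :=
  forall w w', all2 leq w w' -> P w -> P w'.

Lemma indicator_upset_homo (P : pred (seq nat)) : upset P ->
  {homo (fun w => (P w)%:R : R) : w w' / all2 leq w w' >-> w <= w'}.
Proof. by move=> Pup w w' /Pup; rewrite ler_nat; case: (P w) => // ->. Qed.

Lemma vecE_bool_itv q N n (P : pred (seq nat)) : 0 <= q <= 1 ->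
  0 <= vecE q N n (fun w => (P w)%:R) <= 1.
Proof.
move=> q01; apply/andP; split; first exact: vecE_ge0.
rewrite -[leRHS](vecE_cst q N n); apply: vecE_le => // w.
by rewrite lern1 leq_b1.
Qed.

Lemma vecE_compl q N n (P : pred (seq nat)) :
  vecE q N n (fun w => (~~ P w)%:R) = 1 - vecE q N n (fun w => (P w)%:R).
Proof.
rewrite -[X in X - _](vecE_cst q N n) -[in RHS]mulN1r -vecEZ -vecED.
by congr vecE; apply/funext => w; case: (P w); rewrite mulN1r ?subrr ?subr0.
Qed.

Lemma vecE_upset_exp q N n (P : pred (seq nat)) k : 0 <= q <= 1 -> upset P ->
  vecE (q ^+ k) N n (fun w => (P w)%:R) <= vecE q N n (fun w => (P w)%:R) ^+ k.
Proof.
move=> q01 Pup; elim: k => [|k IHk].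
  have one01 : 0 <= (1 : R) <= 1 by rewrite ler01 lexx.
  by rewrite !expr0; have /andP[] := vecE_bool_itv N n P one01.
have qk01 : 0 <= q ^+ k <= 1.
  by case/andP: q01 => *; rewrite exprn_ge0 ?exprn_ile1.
have qS01 : 0 <= q * q ^+ k <= 1.
  by case/andP: q01 => *; rewrite -exprS exprn_ge0 ?exprn_ile1.
have /andP[p0 _] := @vecE_bool_itv q N n P q01.
rewrite exprS [leRHS]exprS; apply: le_trans (ler_wpM2l p0 IHk).
have PS := indicator_upset_homo Pup.
(* An indicator is its own square, so the product inequality applies. *)
have -> : vecE (q * q ^+ k) N n (fun w => (P w)%:R) =
    vecE (q * q ^+ k) N n (fun w => (P w)%:R * (P w)%:R).
  by congr vecE; apply/funext => w; rewrite -natrM mulnb andbb.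
by apply: (@vecE_mul leq) => // phi psi; apply: geoE_mul_min.
Qed.

(** The complement of [P] is decreasing, so the inequality for maxima can be iterated [k] times. *)
Lemma vecE_upset_mulrn q N n (P : pred (seq nat)) k :
  0 <= q -> k%:R * q <= 1 -> upset P ->
  1 - vecE (k%:R * q) N n (fun w => (P w)%:R) <=
  (1 - vecE q N n (fun w => (P w)%:R)) ^+ k.
Proof.
move=> q0 kq1 Pup; rewrite -!vecE_compl; elim: k kq1 => [|k IHk] kq1.
  have zero01 : 0 <= 0 * q <= 1 by rewrite mul0r lexx ler01.
  by rewrite expr0; have /andP[] := vecE_bool_itv N n (predC P) zero01.
have kq0 : 0 <= k%:R * q by rewrite mulr_ge0.
move: kq1; rewrite -natr1 mulrDl mul1r => kq1.
have q01 : 0 <= q <= 1 by lra.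
have /andP[p0 _] := vecE_bool_itv N n (predC P) q01.
have {}IHk : vecE (k%:R * q) N n (fun w => (~~ P w)%:R) <=
    vecE q N n (fun w => (~~ P w)%:R) ^+ k.
  by apply: IHk; apply: le_trans kq1; rewrite lerDl.
rewrite exprS addrC; apply: le_trans (ler_wpM2l p0 IHk).
have PS : {homo (fun w => (~~ P w)%:R : R) : w w' / all2 geq w w' >-> w <= w'}.
  move=> w w' ww'; have /Pup : all2 leq w' w.
    by elim: w w' ww' => [|j w IHw] [|j' w'] //= /andP[-> /IHw].
  by rewrite ler_nat; case: (P w') => [-> | _] //; exact: leq_b1.
have -> : vecE (q + k%:R * q) N n (fun w => (~~ P w)%:R) =
    vecE (q + k%:R * q) N n (fun w => (~~ P w)%:R * (~~ P w)%:R).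
  by congr vecE; apply/funext => w; rewrite -natrM mulnb andbb.
apply: (@vecE_mul geq) => //; try lra.
  by move=> j; apply: leqnn.
by move=> phi psi; apply: geoE_mul_max; lra.
Qed.

(** * Multisets of a given size *)

(** Sum of [f] over the multisets of size [s] on [n] elements, by the first multiplicity; for
    [f = 1] it counts them. *)
Fixpoint level (n s : nat) f : R :=
  if n is n'.+1 then
    \sum_(j < s.+1) level n' (s - j) (fun w => f ((j : nat) :: w))
  else if s is 0%N then f [::] else 0.

Lemma level_le n s f g : (forall w, f w <= g w) -> level n s f <= level n s g.
Proof.
elim: n s f g => [|n IHn] s f g fg /=; first by case: s.
by apply: ler_sum => j _; apply: IHn.
Qed.

Lemma levelN n s f : level n s (fun w => - f w) = - level n s f.
Proof.
elim: n s f => [|n IHn] s f /=; first by case: s; rewrite ?oppr0.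
by rewrite -sumrN; apply: eq_bigr => j _; rewrite IHn.
Qed.

(* Polya's urn: adding to a multiset [w] the element [i] with weight [w_i + 1]
   distributes the multisets of size [s + 1] uniformly. *)
Lemma level_succ n s f : {homo f : w w' / all2 leq w w' >-> w <= w'} ->
  (n + s)%:R * level n s f <= s.+1%:R * level n s.+1 f.
Proof.
elim: n s f => [|n IHn] s f fS.
  by case: s => [|s] /=; rewrite ?mul0r ?mulr0.
have rr w : all2 leq w w by elim: w => //= j w ->; rewrite leqnn.
pose F j w := f (j :: w).
(* The weight [n.+1 + s] splits as [(n + (s - j)) + j.+1]: the new element joins the tail ([le1]) or
   raises the head [j] ([le2]). *)
have le1 : \sum_(j < s.+1) (n + (s - j))%:R * level n (s - j) (F j)
    <= \sum_(j < s.+2) (s.+1 - j)%:R * level n (s.+1 - j) (F j).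
  rewrite [leRHS]big_ord_recr /= subnn mul0r addr0; apply: ler_sum => j _.
  rewrite subSn; last by rewrite -ltnS.
  by apply: IHn => w w' ww'; apply: fS; rewrite /= leqnn.
have le2 : \sum_(j < s.+1) j.+1%:R * level n (s - j) (F j)
    <= \sum_(j < s.+2) j%:R * level n (s.+1 - j) (F j).
  rewrite [leRHS]big_ord_recl /= mul0r add0r; apply: ler_sum => j _.
  rewrite ler_wpM2l //; apply: level_le => w.
  by apply: fS; rewrite /= rr andbT leqnSn.
apply: le_trans (le_trans (lerD le1 le2) _).
  rewrite /= mulr_sumr -big_split /=; apply: ler_sum => j _.
  by rewrite -mulrDl -natrD addnS -addnA subnK // -ltnS.
rewrite /= mulr_sumr -big_split /=; apply: ler_sum => j _.
by rewrite -mulrDl -natrD subnK // -ltnS.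
Qed.

Definition level_mean n s f : R := level n s f / level n s (fun=> 1).

Lemma level1_succ n s :
  (n + s)%:R * level n s (fun=> 1) = s.+1%:R * level n s.+1 (fun=> 1).
Proof.
apply/eqP; rewrite eq_le level_succ //=.
(* The constant [-1] is monotone too and gives the reverse inequality. *)
by have := @level_succ n s (fun=> -1); rewrite !levelN !mulrN lerN2; apply.
Qed.

Lemma level1_gt0 n s : (0 < n)%N -> 0 < level n s (fun=> 1).
Proof.
move=> n0; elim: s => [|s IHs].
  by elim: n {n0} => [|n IHn] //=; rewrite big_ord1.
rewrite -(pmulr_rgt0 _ (ltr0Sn R s)) -level1_succ pmulr_rgt0 //.
by rewrite ltr0n addn_gt0 n0.
Qed.

(** One step of size is [level_succ] divided by the identity [level1_succ]. *)
Lemma level_mean_le n r s f : (0 < n)%N -> (r <= s)%N ->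
  {homo f : w w' / all2 leq w w' >-> w <= w'} ->
  level_mean n r f <= level_mean n s f.
Proof.
move=> n0 rs fS; elim: s rs => [|s IHs]; first by rewrite leqn0 => /eqP ->.
rewrite leq_eqVlt => /orP[/eqP -> //|/IHs] /le_trans; apply.
have l0 := level1_gt0 s n0; have l1 := level1_gt0 s.+1 n0.
rewrite /level_mean ler_pdivrMr // mulrAC ler_pdivlMr //.
have s0 := ltr0Sn R s.
rewrite -(ler_pM2l s0) mulrCA -level1_succ mulrCA mulrA [leRHS]mulrA.
by rewrite ler_pM2r // level_succ.
Qed.

(** * Comparison of geometric and uniform multisets *)

(** All words of sum [s] have the same weight, so the law given the size is uniform; [s < N] keeps
    every entry below the cap. *)
Lemma vecE_level q N n s f : (s < N)%N ->
  vecE q N n (fun w => f w * (sumn w == s)%:R) =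
  (1 - q) ^+ n * q ^+ s * level n s f.
Proof.
elim: n s f => [|n IHn] s f sN /=.
  by case: s {sN} => [|s] /=; rewrite ?mulr0 // !expr0; ring.
have sub j : (j <= s)%N ->
    vecE q N n (fun w => f (j :: w) * ((j + sumn w)%N == s)%:R) =
    (1 - q) ^+ n * q ^+ (s - j) * level n (s - j) (fun w => f (j :: w)).
  move=> js; rewrite -IHn ?(leq_ltn_trans (leq_subr _ _)) //.
  by congr vecE; apply/funext => w; rewrite -{1}(subnKC js) eqn_add2l.
rewrite (@geoE_supp _ _ s) // => [|j sj]; last first.
  under eq_fun => w do rewrite gtn_eqF ?(leq_trans sj) ?leq_addr ?mulr0 //.
  by rewrite vecE_cst.
rewrite mulr_sumr; apply: eq_bigr => j _.
have js : (j <= s)%N by rewrite -ltnS.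
have -> : q ^+ s = q ^+ j * q ^+ (s - j) by rewrite -exprD subnKC.
by rewrite sub // exprS; ring.
Qed.

Lemma vecE_level_itv q N n l u f : (u <= N)%N ->
  vecE q N n (fun w => f w * (l <= sumn w < u)%N%:R) =
  \sum_(l <= s < u) (1 - q) ^+ n * q ^+ s * level n s f.
Proof.
move=> uN; rewrite [RHS](eq_big_nat _ _ (F2 := fun s =>
  vecE q N n (fun w => f w * (sumn w == s)%:R))) => [|s /andP[_ su]].
  rewrite -vecE_sum; congr vecE; apply/funext => w.
  rewrite -mulr_sumr; congr (_ * _).
  under eq_bigr do rewrite eq_sym mulrb; rewrite -big_mkcond big_nat1_eq.
  by case: ifP.
by rewrite vecE_level // (leq_trans su).
Qed.

Lemma level_mean_ge0 n s f : (forall w, 0 <= f w) -> 0 <= level_mean n s f.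
Proof.
have lvl0 g : (forall w, 0 <= g w) -> 0 <= level n s g.
  elim: n s g => [|n IHn] s g g0 /=; first by case: s.
  by apply: sumr_ge0 => j _; apply: IHn.
by move=> f0; rewrite divr_ge0 ?lvl0.
Qed.

(** The size lies in [[r, N)] with probability at least [1 - 1/2 - 1/4], and on each such level [P]
    is at least as likely as at size [r]. *)
Lemma level_mean_le_vecE q N n r (P : pred (seq nat)) :
  (0 < n)%N -> (0 < r <= N)%N -> 0 <= q < 1 ->
  8 * r%:R * (1 - q) <= n%:R * q -> 4 * (n%:R * (q / (1 - q))) <= N%:R ->
  upset P ->
  level_mean n r (fun w => (P w)%:R) <= 4 * vecE q N n (fun w => (P w)%:R).
Proof.
move=> n0 /andP[r0 rN] q01 rq Nq Pup; have /andP[q0 q1] := q01.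
have q01' : 0 <= q <= 1 by rewrite q0 ltW.
have Pmono := indicator_upset_homo Pup.
set p := level_mean _ _ _.
have p0 : 0 <= p by apply: level_mean_ge0.
have N0 : 0 < N%:R :> R by rewrite ltr0n (leq_trans r0).
have lower := vecE_lower_tail q01 (introT andP (conj r0 rN)) rq.
have upper : vecE q N n (fun w => (N <= sumn w)%:R) <= 4^-1.
  by have := vecE_upper_tail N n N q01; nra.
have mid : 4^-1 <= vecE q N n (fun w => 1 * (r <= sumn w < N)%N%:R).
  have : vecE q N n (fun=> 1) <= vecE q N n (fun w => (sumn w < r)%:R +
      ((N <= sumn w)%:R + 1 * (r <= sumn w < N)%N%:R)).
    apply: vecE_le => // w; rewrite mul1r -!natrD ler1n.
    rewrite !(leqNgt _ (sumn w)).
    by case: (sumn w < r)%N; case: (sumn w < N)%N.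
  by rewrite vecE_cst !vecED; lra.
have : p * vecE q N n (fun w => 1 * (r <= sumn w < N)%N%:R) <=
    vecE q N n (fun w => (P w)%:R * (r <= sumn w < N)%N%:R).
  rewrite !vecE_level_itv // mulr_sumr ler_sum_nat // => s /andP[rs _].
  rewrite mulrCA; apply: ler_wpM2l.
    by rewrite mulr_ge0 ?exprn_ge0 //; lra.
  by rewrite -ler_pdivlMr ?level1_gt0 // level_mean_le.
have : vecE q N n (fun w => (P w)%:R * (r <= sumn w < N)%N%:R) <=
    vecE q N n (fun w => (P w)%:R).
  by apply: vecE_le => // w; rewrite ler_piMr // lern1 leq_b1.
nra.
Qed.

(** On levels up to [s], [P] is at most as likely as at size [s]; larger sizes go into the tail
    term. *)
Lemma vecE_le_level_mean q N n s (P : pred (seq nat)) :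
  (0 < n)%N -> (s < N)%N -> 0 <= q < 1 -> upset P ->
  vecE q N n (fun w => (P w)%:R) <=
  level_mean n s (fun w => (P w)%:R) + vecE q N n (fun w => (s < sumn w)%:R).
Proof.
move=> n0 sN q01 Pup; have /andP[q0 q1] := q01.
have q01' : 0 <= q <= 1 by rewrite q0 ltW.
have Pmono := indicator_upset_homo Pup.
set p := level_mean _ _ _.
have p0 : 0 <= p by apply: level_mean_ge0.
apply: (@le_trans _ _ (vecE q N n (fun w => (P w)%:R * (0 <= sumn w < s.+1)%N%:R
    + (s < sumn w)%:R))).
  apply: vecE_le => // w; rewrite leq0n /= ltnS; case: leqP => _.
    by rewrite mulr1 addr0.
  by rewrite mulr0 add0r lern1 leq_b1.
rewrite vecED lerD2r.
apply: (@le_trans _ _ (p *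
    vecE q N n (fun w => 1 * (0 <= sumn w < s.+1)%N%:R))).
  rewrite !vecE_level_itv // mulr_sumr ler_sum_nat // => i /andP[_ si].
  rewrite [leRHS]mulrCA; apply: ler_wpM2l.
    by rewrite mulr_ge0 ?exprn_ge0 //; lra.
  by rewrite -ler_pdivrMr ?level1_gt0 // level_mean_le.
rewrite ler_piMr // -[leRHS](vecE_cst q N n); apply: vecE_le => // w.
by rewrite mul1r lern1 leq_b1.
Qed.

(** As [q / (1 - q)] is the uncapped mean of an entry, the hypotheses on [q] and [q'] say that the
    means are at least [M] and at most a constant times [M]. Neither parameter depends on [N], [n]
    or [P]. *)
Lemma geometric_coarse_threshold (d M : R) k :
  0 < d < 1 -> (0 < k)%N -> (1 - d) ^+ k <= d -> 0 < M ->
  exists q q' : R, [/\ 0 <= q < 1, 0 <= q' < 1, M * (1 - q) <= q,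
    q' <= (2 * k * 2 ^ k)%:R * M * (1 - q') &
    forall N n P, upset P ->
      vecE q N n (fun w => (P w)%:R) <= d \/
      1 - d <= vecE q' N n (fun w => (P w)%:R)].
Proof.
(* The parameters are q and k q if the mean M is small, q'^k and q' if not. *)
move=> /andP[d0 d1] k0 dk M0.
have k1 : 1 <= k%:R :> R by rewrite ler1n.
have kk1 : 1 <= 2 ^+ k :> R by rewrite exprn_ege1 // ler1n.
rewrite !natrM natrX; set K : R := 2 * k%:R * 2 ^+ k.
have [kM|kM] := lerP (k%:R * M) 2^-1.
  pose q := M / (1 + M).
  have qE : q * (1 + M) = M by rewrite /q; field; lra.
  have q0 : 0 < q by rewrite divr_gt0; lra.
  have qM : q <= M by nra.
  have kq : k%:R * q <= k%:R * M by rewrite ler_wpM2l.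
  have kq0 : 0 <= k%:R * q by rewrite mulr_ge0 // ltW.
  exists q, (k%:R * q); split => [||||N n P Pup]; try nra.
    have : k%:R * M <= k%:R * M * 2 ^+ k by rewrite ler_peMr // mulr_ge0 // ltW.
    rewrite /K; nra.
  have q01 : 0 <= q <= 1 by nra.
  have /andP[lo0 lo1] := vecE_bool_itv N n P q01.
  have kq1 : k%:R * q <= 1 by lra.
  have := vecE_upset_mulrn N n (ltW q0) kq1 Pup.
  set lo := vecE q N n _ in lo0 lo1 *; set hi := vecE (k%:R * q) N n _ => hiP.
  have [?|lod] := lerP lo d; [by left | right].
  have : (1 - lo) ^+ k <= (1 - d) ^+ k by rewrite lerXn2r // ?nnegrE; lra.
  lra.
(* The larger parameter has mean exactly [K * M >= 1], hence is at least [1 / 2]. *)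
pose m := K * M.
have m1 : 1 <= m.
  have -> : m = 2 * ((k%:R * M) * 2 ^+ k) by rewrite /m /K; ring.
  have := ler_wpM2l (ltW (lt_trans _ kM)) kk1; rewrite invr_gt0 ltr0n mulr1.
  by move=> /(_ isT); lra.
pose q := m / (1 + m).
have qE : q = m * (1 - q) by rewrite /q; field; lra.
have q0 : 2^-1 <= q by nra.
have q1 : q < 1 by nra.
have qk0 : (2 ^+ k)^-1 <= q ^+ k by rewrite -exprVn lerXn2r // ?nnegrE; lra.
have qk1 : q ^+ k < 1 by rewrite exprn_ilt1 -?lt0n //; lra.
have qk2 : 0 <= q ^+ k by rewrite exprn_ge0; lra.
exists (q ^+ k), q; split => [||||N n P Pup]; try lra.
(* Bernoulli gives [1 - q ^+ k <= k * (1 - q)], and [k * M * (1 - q) = q / (2 * 2 ^+ k)] is below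
   [q ^+ k]. *)
- have xN1 : -1 <= q - 1 by lra.
  have := bernoulli k xN1; rewrite [1 + (q - 1)]addrC subrK => bq.
  apply: le_trans qk0.
  have e : 2 ^+ k * (k%:R * M * (1 - q)) = q / 2.
    by rewrite {2}qE /m /K; field.
  rewrite -[leRHS]mulr1 ler_pdivlMl; last lra.
  have : M * (1 - q ^+ k) <= k%:R * M * (1 - q) by nra.
  by move=> /(ler_wpM2l (le_trans ler01 kk1)); rewrite e; lra.
- by rewrite -/m -qE.
have q01 : 0 <= q <= 1 by lra.
have := vecE_upset_exp N n k q01 Pup.
have /andP[hi0 hi1] := vecE_bool_itv N n P q01.
set hi := vecE q N n _ in hi0 hi1 *; set lo := vecE (q ^+ k) N n _ => loP.
have [?|hid] := lerP (1 - d) hi; [by right | left].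
have : hi ^+ k <= (1 - d) ^+ k by rewrite lerXn2r // ?nnegrE; lra.
lra.
Qed.

End GeometricProduct.

(** * Coarse thresholds for increasing families *)

(** From [(1 - d) * (1 + d) <= 1] and Bernoulli, the power is at most [1 / (1 + k * d)], which is at
    most [d] once [k * d ^+ 2 >= 1]. *)
Lemma exists_expr_onem_le (R : archiRealFieldType) (d : R) : 0 < d < 1 ->
  exists2 k, (0 < k)%N & (1 - d) ^+ k <= d.
Proof.
move=> /andP[d0 d1]; pose k := (Num.truncn (d ^- 2)).+1; exists k => //.
have kd : 1 <= k%:R * d ^+ 2.
  by rewrite -ler_pdivrMr ?exprn_gt0 // mul1r ltW // truncnS_gt.
have dN1 : -1 <= d by lra.
have := bernoulli k dN1.
have a0 : 0 <= (1 - d) ^+ k by rewrite exprn_ge0; lra.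
have : (1 - d) ^+ k * (1 + d) ^+ k <= 1.
  by rewrite -exprMn exprn_ile1 //; nra.
rewrite expr2 in kd *; set a := (1 - d) ^+ k in a0 *.
set b := (1 + d) ^+ k => ab kb.
have : a * (1 + k%:R * d) <= 1 by nra.
have : a <= a * (k%:R * (d * d)) by nra.
nra.
Qed.

(** The constant [K] depends on [d] alone, so it serves a whole sequence of graphs. *)
Lemma upset_coarse_threshold (R : archiRealFieldType) (d : R) : 0 < d ->
  exists2 K : R, 1 <= K & forall n r s P, (0 < n)%N -> (0 < r)%N ->
    K * r%:R <= s%:R -> upset P ->
    level_mean n r (fun w => (P w)%:R) <= d \/
    1 - d <= level_mean n s (fun w => (P w)%:R) :> R.
Proof.
(* The transfer to uniform multisets costs a factor 4 at size [r] and a further [e] at size [s]. *)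
move=> d0; pose e : R := Num.min (d / 4) 2^-1.
have e_gt0 : 0 < e by rewrite lt_min; lra.
have [e_d e2] : e <= d / 4 /\ e <= 2^-1.
  by rewrite /e; split; rewrite ge_min lexx ?orbT.
have e01 : 0 < e < 1 by lra.
have [k k0 ek] := exists_expr_onem_le e01.
pose L : R := (2 * k * 2 ^ k)%:R.
have L1 : 1 <= L by rewrite ler1n !muln_gt0 k0 expn_gt0.
(* Chosen so that Markov's bound [n * L * M / s = 8 * L * r / s] is at most [e]. *)
pose K := 8 * L / e.
have KE : K * e = 8 * L by rewrite /K; field; lra.
have K1 : 1 <= K by nra.
exists K => // n r s P n0 r0 Krs Pup.
have n0' : 0 < n%:R :> R by rewrite ltr0n.
have r1 : 1 <= r%:R :> R by rewrite ler1n.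
(* The mean per entry required by the lower tail bound at size [r]. *)
pose M : R := 8 * r%:R / n%:R.
have nM : n%:R * M = 8 * r%:R by rewrite /M; field; lra.
have M0 : 0 < M by rewrite divr_gt0 //; lra.
have [q [q' [q01 q'01 Mq q'M cut]]] := geometric_coarse_threshold e01 k0 ek M0.
rewrite -/L in q'M.
have rq : 8 * r%:R * (1 - q) <= n%:R * q.
  by rewrite -nM -mulrA ler_wpM2l // ltW.
have s0 : 0 < s%:R :> R by nra.
(* The cap exceeds [r], [s] and four times the mean size. *)
pose N := (r + s + Num.truncn (4 * (n%:R * (q / (1 - q))))).+1.
have rN : (0 < r <= N)%N by rewrite r0 /N -addnS -addnA leq_addr.
have sN : (s < N)%N by rewrite ltnS addnAC leq_addl.
have qN : 4 * (n%:R * (q / (1 - q))) <= N%:R.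
  apply: ltW; apply: lt_le_trans (truncnS_gt _) _.
  by rewrite ler_nat ltnS leq_addl.
have lo := level_mean_le_vecE n0 rN q01 rq qN Pup.
have hi := vecE_le_level_mean n0 sN q'01 Pup.
have tail : vecE q' N n (fun w => (s < sumn w)%:R) <= e.
  have := vecE_upper_tail N n s.+1 q'01; rewrite -(natr1 s).
  have : n%:R * (q' / (1 - q')) <= n%:R * (L * M).
    by apply: ler_wpM2l; [exact: ltW | rewrite ler_pdivrMr //; lra].
  have -> : n%:R * (L * M) = e * (K * r%:R).
    by rewrite mulrCA nM mulrA [e * K]mulrC KE; ring.
  have t0 : 0 <= vecE q' N n (fun w => (s < sumn w)%:R).
    by apply: vecE_ge0 => //; lra.
  move: t0; set t := vecE q' N n _; move=> t0 le1 le2.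
  have le3 : e * (K * r%:R) <= e * s%:R by rewrite ler_wpM2l // ltW.
  have : t * s%:R <= e * s%:R by nra.
  by rewrite ler_pM2r.
by case: (cut N n P Pup) => h; [left | right]; lra.
Qed.

(** * Pebbling *)

Lemma big_ffun_ordS (V : nmodType) (T : finType) n
    (F : {ffun 'I_n.+1 -> T} -> V) :
  \sum_D F D = \sum_x \sum_D
    F [ffun i =>
      if unlift ord0 i is Some j then (D : {ffun 'I_n -> T}) j else x].
Proof.
rewrite pair_big (reindex (fun p : T * {ffun 'I_n -> T} =>
  [ffun i => if unlift ord0 i is Some j then p.2 j else p.1])) //=.
exists (fun D : {ffun 'I_n.+1 -> T} => (D ord0, [ffun j => D (lift ord0 j)])).
  move=> [x D] _; congr pair; first by rewrite ffunE unlift_none.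
  by apply/ffunP => j; rewrite !ffunE liftK.
move=> D _; apply/ffunP => i; rewrite !ffunE /=.
by case: unliftP => [j|] ->; rewrite ?ffunE.
Qed.

(** Links the recursion to the functions used for pebble distributions; values of a function with
    sum [s] never exceed [s <= N]. *)
Lemma level_ffun (R : realFieldType) n s N (f : seq nat -> R) : (s <= N)%N ->
  level n s f = \sum_(D : {ffun 'I_n -> 'I_N.+1})
    f [seq D i : nat | i <- enum 'I_n] * (\sum_i D i == s)%N%:R.
Proof.
elim: n s f => [|n IHn] s f sN.
  rewrite (big_pred1 [ffun=> ord0]) => [|D]; last first.
    by apply/esym/eqP/ffunP => -[].
  rewrite big_ord0 (size0nil (_ : size [seq _ | _ <- _] = 0%N)); last first.
    by rewrite size_map size_enum_ord.
  by case: s {sN} => [|s]; rewrite ?mulr1 ?mulr0.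
rewrite big_ffun_ordS /= (big_ord_widen N.+1
  (fun j => level n (s - j) (fun w => f (j :: w)))) //.
rewrite big_mkcond /=; apply: eq_bigr => x _.
have sumE (D : {ffun 'I_n -> 'I_N.+1}) :
    (\sum_i [ffun i => if unlift ord0 i is Some j then D j else x] i)%N =
    (x + \sum_i D i)%N.
  rewrite big_ord_recl ffunE unlift_none; congr (_ + _)%N.
  by apply: eq_bigr => i _; rewrite ffunE liftK.
have seqE (D : {ffun 'I_n -> 'I_N.+1}) :
    [seq [ffun i => if unlift ord0 i is Some j then D j else x] i : nat
       | i <- enum 'I_n.+1] = (x : nat) :: [seq D i : nat | i <- enum 'I_n].
  rewrite enum_ordSl /= ffunE unlift_none -map_comp; congr cons.
  by apply: eq_map => i /=; rewrite ffunE liftK.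
under [RHS]eq_bigr do rewrite sumE seqE.
rewrite ltnS; case: leqP => [xs|sx].
  rewrite IHn ?(leq_trans (leq_subr _ _)) //; apply: eq_bigr => D _.
  by rewrite -{2}(subnKC xs) eqn_add2l.
rewrite big1 // => D _; rewrite gtn_eqF ?mulr0 //.
by rewrite (leq_trans sx) // leq_addr.
Qed.

Section Solvability.
Variables (V : finType) (e : rel V).
Implicit Types D E : {ffun V -> nat}.

(** The same moves are played while the extra pebbles stay in place. *)
Lemma reachable_le D E D' : reachable e D E -> (forall v, D v <= D' v)%N ->
  exists2 E', reachable e D' E' & forall v, (E v <= E' v)%N.
Proof.
move=> DE; elim: DE D' =>
  {D E} [D _ [v [v' [evv' Dv ->]]]|D|D E F _ IH1 _ IH2] D' leD.
- exists (move D' v v').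
    by apply: rt_step; exists v, v'; split => //; apply: leq_trans (leD v).
  by move=> u; rewrite !ffunE leq_add2r leq_sub2r.
- by exists D' => //; apply: rt_refl.
- have [E' DE' leE] := IH1 _ leD; have [F' EF' leF] := IH2 _ leE.
  by exists F' => //; apply: rt_trans EF'.
Qed.

Lemma solvable_le D D' : (forall v, D v <= D' v)%N ->
  solvable e D -> solvable e D'.
Proof.
move=> leD sD z; have [E [DE Ez]] := sD z.
have [E' DE' leE] := reachable_le DE leD.
by exists E'; split => //; apply: leq_trans (leE z).
Qed.

Lemma reachable_empty D E : reachable e D E -> (forall v, D v = 0%N) ->
  forall v, E v = 0%N.
Proof.
move=> DE; elim: DE =>
  {D E} [D E [v [v' [_ Dv _]]] D0|//|D E F _ IH1 _ IH2 /IH1/IH2 //].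
by rewrite D0 in Dv.
Qed.

Hypothesis e_irr : irreflexive e.

Lemma reachable_moves D v v' m : e v v' -> (2 * m <= D v)%N ->
  exists2 E, reachable e D E & (D v' + m <= E v')%N.
Proof.
move=> evv'; have vv' : v != v' by apply: contraTneq evv' => ->; rewrite e_irr.
elim: m D => [|m IHm] D mD; first by exists D; [apply: rt_refl | rewrite addn0].
have [|E ME leE] := IHm (move D v v').
  by rewrite ffunE eqxx (negPf vv'); move: mD; rewrite mulnS; lia.
exists E.
  apply: rt_trans ME; apply: rt_step; exists v, v'; split => //.
  by apply: leq_trans mD; rewrite leq_pmulr.
by apply: leq_trans leE; rewrite ffunE eqxx eq_sym (negPf vv'); lia.
Qed.

(** Pushing pebbles along an edge halves their number. *)
Lemma solvable_at_path D v p : path e v p -> (2 ^ size p <= D v)%N ->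
  solvable_at e (last v p) D.
Proof.
elim: p v D => [|v' p IHp] v D /=.
  by exists D; split => //; apply: rt_refl.
case/andP=> evv' v'p; rewrite expnS => /(reachable_moves evv')[E DE leE].
have [|F [EF Fz]] := IHp v' E v'p.
  by apply: leq_trans leE; rewrite leq_addl.
by exists F; split => //; apply: rt_trans EF.
Qed.

(** By pigeonhole some vertex carries [2 ^ #|V|] pebbles, and a path without repetition has fewer
    than [#|V|] edges. *)
Lemma solvable_large D : connected_graph e -> (0 < #|V|)%N ->
  (#|V| * 2 ^ #|V| <= \sum_v D v)%N -> solvable e D.
Proof.
move=> e_conn V0 largeD z.
have [v Dv] : exists v, (2 ^ #|V| <= D v)%N.
  apply/existsP; apply: contraLR largeD; rewrite negb_exists => /forallP small.
  rewrite -ltnNge; apply: (@leq_trans (\sum_v (D v + 1))%N).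
    by rewrite big_split /= sum1_card -ltn_psubLR ?subnn.
  rewrite -sum_nat_const; apply: leq_sum => v _.
  by rewrite addn1 ltnNge small.
have /connectP[p vp ->] := e_conn v z.
case/shortenP: vp => p' vp' up' _; apply: solvable_at_path => //.
apply: leq_trans Dv; rewrite leq_exp2l // ltnW //.
by have := max_card (mem (v :: p')); rewrite (card_uniqP up').
Qed.

End Solvability.

(** * Probability of solvability and its median *)

Section Probability.
Variables (R : realType) (G : forall n : nat, rel 'I_n).

Definition solvable_seq n : pred (seq nat) :=
  fun w => `[< solvable (@G n) [ffun v : 'I_n => nth 0%N w v] >].

Lemma solvable_seq_upset n : upset (solvable_seq n).
Proof.
move=> w w' ww' /asboolP sw; apply/asboolP; apply: solvable_le sw => v.
rewrite !ffunE; elim: w w' ww' (v : nat) => [|j w IHw] [|j' w'] //=.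
by case/andP=> jj' /IHw ww' [|i] //=.
Qed.

Lemma card_distributions_level n r :
  #|distributions_of_size 'I_n r|%:R = level n r (fun=> 1 : R).
Proof.
rewrite (level_ffun _ _ (leqnn r)) -sum1_card natr_sum big_mkcond.
by apply: eq_bigr => D _; rewrite inE mul1r mulrb.
Qed.

Lemma solvable_probE n r :
  solvable_prob R G n r = level_mean n r (fun w => (solvable_seq n w)%:R).
Proof.
rewrite /solvable_prob card_distributions_level; congr (_ / _).
rewrite (level_ffun _ _ (leqnn r)) -sum1_card natr_sum big_mkcond.
apply: eq_bigr => D _; rewrite !inE -natrM mulnb andbC mulrb.
congr (if _ && _ then _ else _).
congr `[< solvable _ _ >]; apply/ffunP => v; rewrite !ffunE.
by rewrite (nth_map v) ?size_enum_ord // nth_ord_enum.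
Qed.

Lemma solvable_prob_le1 n r : (0 < n)%N -> solvable_prob R G n r <= 1.
Proof.
move=> n0; rewrite solvable_probE ler_pdivrMr ?level1_gt0 // mul1r.
by apply: level_le => w; rewrite lern1 leq_b1.
Qed.

Lemma solvable_prob_ge0 n r : 0 <= solvable_prob R G n r.
Proof. by rewrite divr_ge0. Qed.

(** Without pebbles no move is possible. This makes the median positive and settles sizes rounded to
    0. *)
Lemma solvable_prob0 n : (0 < n)%N -> solvable_prob R G n 0 = 0.
Proof.
case: n => // n _; rewrite /solvable_prob.
rewrite (_ : solvable_of_size _ _ = finset.set0) ?cards0 ?mul0r //.
apply/setP => D; rewrite !inE; apply/negbTE/negP => /andP[/eqP D0 /asboolP sD].
have [E [DE]] := sD ord0; rewrite (reachable_empty DE) // => v.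
by rewrite ffunE; move/eqP: D0; rewrite sum_nat_eq0 => /forallP/(_ v)/eqP.
Qed.

Hypothesis G_simple : forall n, simple_graph (@G n).
Hypothesis G_connected : forall n, connected_graph (@G n).

Lemma solvable_prob_large n : (0 < n)%N ->
  solvable_prob R G n (n * 2 ^ n) = 1.
Proof.
move=> n0; rewrite /solvable_prob.
rewrite (_ : solvable_of_size _ _ = distributions_of_size _ _).
  by rewrite divff // card_distributions_level gt_eqF ?level1_gt0.
apply/setP => D; rewrite !inE; apply: andb_idr => /eqP sumD; apply/asboolP.
apply: solvable_large; rewrite ?card_ord //; first by case: (G_simple n).
by under eq_bigr do rewrite ffunE; rewrite sumD.
Qed.

(** A size of probability 1 exists, so [xget] does not fall back on its default. *)
Lemma median_sizeP n : (0 < n)%N ->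
  2^-1 <= solvable_prob R G n (median_size R G n) /\
  forall s, 2^-1 <= solvable_prob R G n s -> (median_size R G n <= s)%N.
Proof.
move=> n0; have exr : exists r, 2^-1 <= solvable_prob R G n r.
  by exists (n * 2 ^ n)%N; rewrite solvable_prob_large //; lra.
have exmin : exists r, [set r : nat | 2^-1 <= solvable_prob R G n r /\
    forall s, 2^-1 <= solvable_prob R G n s -> (r <= s)%N]%classic r.
  by case: (ex_minnP exr) => r pr minr; exists r.
exact: (xgetPex 0%N exmin).
Qed.

End Probability.

Theorem theorem3 (R : realType) (G : forall n : nat, rel 'I_n)
    (G_simple : forall n : nat, simple_graph (G n))
    (G_connected : forall n : nat, connected_graph (G n)) :
  is_threshold G (fun n : nat => (median_size R G n)%:R : R).
Proof.
move=> w w_oo; split; apply/cvgrPdist_le => d d0.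
  (* The bound [1 / 4] makes the first alternative of [cut] incompatible with probability at least
     [1 / 2] at the median. *)
  have d4 : 0 < Num.min d 4^-1 by rewrite lt_min d0; lra.
  have [K K1 cut] := upset_coarse_threshold d4.
  have [dd d14] : Num.min d 4^-1 <= d /\ Num.min d 4^-1 <= 4^-1.
    by split; rewrite ge_min lexx ?orbT.
  move/cvgryPge/(_ (K + 1)) : w_oo => w_large.
  near=> n; have n0 : (0 < n)%N by near: n; exists 1%N.
  have wK : K + 1 <= w n by near: n.
  set t := median_size R G n; set s := nearest_nat _.
  have [pt _] := median_sizeP R G_simple G_connected n0; rewrite -/t in pt.
  have t0 : (0 < t)%N.
    rewrite lt0n; apply: contraTneq pt => ->.
    by rewrite solvable_prob0 // -ltNge; lra.
  have t1 : 1 <= t%:R :> R by rewrite ler1n.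
  (* Rounding loses at most [1 / 2], which the extra 1 in [K + 1] absorbs since [t >= 1]. *)
  have ts : K * t%:R <= s%:R.
    have : t%:R * w n + 2^-1 < s%:R + 1 by rewrite natr1; apply: truncnS_gt.
    have := ler_wpM2l (le_trans ler01 t1) wK; lra.
  have := cut n t s _ n0 t0 ts (@solvable_seq_upset G n).
  rewrite -!solvable_probE => -[|ps]; first lra.
  by rewrite ger0_norm ?subr_ge0 ?solvable_prob_le1 //; lra.
have d4 : 0 < Num.min d 4^-1 by rewrite lt_min d0; lra.
have [K K1 cut] := upset_coarse_threshold d4.
have [dd d14] : Num.min d 4^-1 <= d /\ Num.min d 4^-1 <= 4^-1.
  by split; rewrite ge_min lexx ?orbT.
move/cvgryPge/(_ (2 * K + 2)) : w_oo => w_large.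
near=> n; have n0 : (0 < n)%N by near: n; exists 1%N.
have wK : 2 * K + 2 <= w n by near: n.
set t := median_size R G n; set s := nearest_nat _.
rewrite sub0r normrN ger0_norm ?solvable_prob_ge0 //.
have [-> |s0] := posnP s; first by rewrite solvable_prob0 // ltW.
have [_ tmin] := median_sizeP R G_simple G_connected n0; rewrite -/t in tmin.
have s1 : 1 <= s%:R :> R by rewrite ler1n.
have w0 : 0 < w n by lra.
have sle : s%:R <= t%:R / w n + 2^-1 :> R.
  by rewrite truncn_le addr_ge0 // divr_ge0 // ltW.
(* As [s >= 1], the rounding error [1 / 2] is at most [s / 2]. *)
have sw : s%:R * w n <= 2 * t%:R.
  have : s%:R <= 2 * (t%:R / w n) by lra.
  by rewrite mulrA ler_pdivlMr.
have Ks : 1 <= K * s%:R by rewrite mulr_ege1.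
have st : K * s%:R + 1 <= t%:R by have := ler_wpM2l (le_trans ler01 s1) wK; lra.
have t0 : (0 < t)%N by rewrite -(ltr0n R); lra.
have st' : K * s%:R <= t.-1%:R by move: st; rewrite -{1}(prednK t0) -natr1; lra.
(* The comparison is with [t.-1]: the second alternative would give it probability at least [3 / 4],
   against the minimality of [t]. *)
have := cut n s t.-1 _ n0 s0 st' (@solvable_seq_upset G n).
rewrite -!solvable_probE => -[|pt]; first by move/le_trans; apply.
have : (t <= t.-1)%N by apply: tmin; lra.
by rewrite leqNgt prednK ?leqnn.
Unshelve. all: by end_near. Qed.
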